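(* Let $\mathcal{A}_j$ be an optimal active set of the multiparametric quadratic program (mpQP), with parametric solution $\lambda^*(\theta)=\tilde q_j+\tilde Q_j\theta$, $z^*(\theta)=k_j+K_j\theta$. Let $l\in\mathcal{A}_j$ be such that $\mathcal{A}_i=\mathcal{A}_j\setminus\{l\}$ is also an optimal active set, and assume $G_{\mathcal{A}_j}$ (hence $G_{\mathcal{A}_i}$) has full row rank. Let $c_j,v_j,f_j,\tilde d_j$ be the rank-one modification data for adding $l$ to $\mathcal{A}_i$ and define $c_i=c_j$, $v_i=v_j$, $\tilde d_i=-\tilde d_j$, $f_i=-f_j$. Then the parametric solution for $\mathcal{A}_i$ is given, for all $\theta\in\mathbb{R}^n$, by $$\lambda^*(\theta)=\tilde q_i+\tilde Q_i\theta=\tilde q_j+\tilde Q_j\theta-\tilde d_i\,(c_i+v_i^T\theta),$$ $$z^*(\theta)=k_i+K_i\theta=k_j+K_j\theta+f_i\,(c_i+v_i^T\theta).$$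
   Context: Problem (mpQP): for a parameter $\theta\in\Theta\subseteq\mathbb{R}^n$ ($\Theta$ a polyhedral set), minimize $\frac12 z^T H z$ over $z\in\mathbb{R}^m$ subject to $Gz\preceq b+S\theta$, where $H\in\mathbb{R}^{m\times m}$ is symmetric positive definite, $G\in\mathbb{R}^{p\times m}$, $b\in\mathbb{R}^p$, $S\in\mathbb{R}^{p\times n}$, and $\preceq$ is componentwise. Lagrange multipliers of the inequalities are denoted $\lambda\in\mathbb{R}^p$ (KKT conditions: $Hz+G^T\lambda=0$, $Gz\preceq b+S\theta$, $\lambda\succeq0$, complementary slackness). Indexing: for an index set $\mathcal{I}\subseteq\{1,\dots,p\}$, $G_{\mathcal{I}}$, $b_{\mathcal{I}}$, $S_{\mathcal{I}}$ denote the rows indexed by $\mathcal{I}$ (and $G_l,b_l,S_l$ the $l$-th rows, $G_l$ and $S_l$ being row vectors); for indexed quantities such as $\tilde q_i,\tilde Q_i,\tilde d_j$, a second index denotes the corresponding entries or rows, e.g. $\tilde q_{i,\mathcal{I}}$. Optimal active set: a set $\mathcal{A}\subseteq\{1,\dots,p\}$ that, for some $\theta\in\Theta$ for which the problem is feasible, is exactly the set of constraints holding with equality at the optimum, with no weakly active constraints (the multipliers indexed by $\mathcal{A}$ are nonzero). Its complement is $\mathcal{N}=\{1,\dots,p\}\setminus\mathcal{A}$. Optimal active sets are denoted $\mathcal{A}_i$, with complements $\mathcal{N}_i$. Standing assumption (LICQ): $G_{\mathcal{A}_i}$ has full row rank. Parametric solution for $\mathcal{A}_i$: the affine functions $\lambda^*(\theta)=\tilde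 q_i+\tilde Q_i\theta$ and $z^*(\theta)=k_i+K_i\theta$, where $\tilde q_i\in\mathbb{R}^p$, $\tilde Q_i\in\mathbb{R}^{p\times n}$ satisfy $\tilde q_{i,\mathcal{N}_i}=0$, $\tilde Q_{i,\mathcal{N}_i}=0$, $$\tilde q_{i,\mathcal{A}_i}=-(G_{\mathcal{A}_i}H^{-1}G_{\mathcal{A}_i}^T)^{-1}b_{\mathcal{A}_i},\qquad \tilde Q_{i,\mathcal{A}_i}=-(G_{\mathcal{A}_i}H^{-1}G_{\mathcal{A}_i}^T)^{-1}S_{\mathcal{A}_i},$$ and $k_i=-H^{-1}G_{\mathcal{A}_i}^T\tilde q_{i,\mathcal{A}_i}\in\mathbb{R}^m$, $K_i=-H^{-1}G_{\mathcal{A}_i}^T\tilde Q_{i,\mathcal{A}_i}\in\mathbb{R}^{m\times n}$. The same definitions apply with $j$ in place of $i$. (This is the primal-dual solution of minimizing $\frac12z^THz$ subject to $G_{\mathcal{A}_i}z=b_{\mathcal{A}_i}+S_{\mathcal{A}_i}\theta$, and it solves the mpQP for $\theta$ in the critical region of $\mathcal{A}_i$.) When $\mathcal{A}_i=\emptyset$, all these quantities are zero. Rank-one modification data for adding $l$ to $\mathcal{A}_i$ (so $\mathcal{A}_j=\mathcal{A}_i\cup\{l\}$, $l\notin\mathcal{A}_i$): put $W=G_{\mathcal{A}_i}H^{-1}G_{\mathcal{A}_i}^T$, $w=G_{\mathcal{A}_i}H^{-1}G_l^T$, $w_0=G_lH^{-1}G_l^T$, $C=w_0-w^TW^{-1}w>0$,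 and $$c_j=C^{-1}(w^TW^{-1}b_{\mathcal{A}_i}-b_l)\in\mathbb{R},\quad v_j=C^{-1}(S_{\mathcal{A}_i}^TW^{-1}w-S_l^T)\in\mathbb{R}^n,$$ $\tilde d_j\in\mathbb{R}^p$ with $\tilde d_{j,\mathcal{A}_i}=W^{-1}w$, $\tilde d_{j,l}=-1$, $\tilde d_{j,\mathcal{N}_j}=0$, and $f_j=H^{-1}G_{\mathcal{A}_j}^T\tilde d_{j,\mathcal{A}_j}\in\mathbb{R}^m$. If $\mathcal{A}_i=\emptyset$, all terms involving $W$ or $w$ are absent (zero). *)

(* Defs.v *)
From HB Require Import structures.
From mathcomp Require Import all_boot all_order all_algebra.
From mathcomp Require Import reals.

Set Implicit Arguments.
Unset Strict Implicit.
Unset Printing Implicit Defensive.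

Import Order.TTheory GRing.Theory Num.Theory.
Local Open Scope ring_scope.

(* The rows of M indexed by A, in increasing order: M_A.  For A = set0 this is
   a matrix with no rows, so every product through it vanishes. *)
Definition rowsof (R : realType) (p k : nat) (A : {set 'I_p})
    (M : 'M[R]_(p, k)) : 'M[R]_(#|A|, k) :=
  rowsub (@enum_val _ (mem A)) M.

(* The matrix with p rows whose A-rows are M and whose other rows are 0; it is
   characterized by rowsof_fillrows and rowsof_fillrowsC below. *)
Definition fillrows (R : realType) (p k : nat) (A : {set 'I_p})
    (M : 'M[R]_(#|A|, k)) : 'M[R]_(p, k) :=
  \matrix_(i, j) \sum_(a < #|A| | enum_val a == i) M a j.

Lemma rowsof_fillrows (R : realType) (p k : nat) (A : {set 'I_p})
  (M : 'M[R]_(#|A|, k)) : rowsof A (fillrows M) = M.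
Proof.
apply/matrixP=> a j; rewrite !mxE (big_pred1 a) // => a'.
by rewrite (inj_eq enum_val_inj).
Qed.

Lemma rowsof_fillrowsC (R : realType) (p k : nat) (A : {set 'I_p})
  (M : 'M[R]_(#|A|, k)) : rowsof (~: A) (fillrows M) = 0.
Proof.
apply/matrixP=> a j; rewrite !mxE big1 // => a' /eqP e.
by have := enum_valP a; rewrite -e inE enum_valP.
Qed.

Definition vle (R : realType) (k : nat) (x y : 'cV[R]_k) : Prop :=
  forall i, x i 0 <= y i 0.

Definition posdef (R : realType) (m : nat) (H : 'M[R]_m) : Prop :=
  H^T = H /\ forall z : 'cV[R]_m, z != 0 -> 0 < (z^T *m H *m z) 0 0.

Definition polyhedral (R : realType) (n : nat) (Theta : 'cV[R]_n -> Prop)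
    : Prop :=
  exists (r : nat) (E : 'M[R]_(r, n)) (e : 'cV[R]_r),
    forall theta, Theta theta <-> vle (E *m theta) e.

Definition qp_cost (R : realType) (m : nat) (H : 'M[R]_m) (z : 'cV[R]_m) : R :=
  2^-1 * (z^T *m H *m z) 0 0.

Definition qp_feasible (R : realType) (m n p : nat) (G : 'M[R]_(p, m))
    (b : 'cV[R]_p) (S : 'M[R]_(p, n)) (theta : 'cV[R]_n) (z : 'cV[R]_m)
    : Prop :=
  vle (G *m z) (b + S *m theta).

Definition qp_optimal (R : realType) (m n p : nat) (H : 'M[R]_m)
    (G : 'M[R]_(p, m)) (b : 'cV[R]_p) (S : 'M[R]_(p, n)) (theta : 'cV[R]_n)
    (z : 'cV[R]_m) : Prop :=
  qp_feasible G b S theta z /\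
  forall z', qp_feasible G b S theta z' -> qp_cost H z <= qp_cost H z'.

Definition qp_KKT (R : realType) (m n p : nat) (H : 'M[R]_m)
    (G : 'M[R]_(p, m)) (b : 'cV[R]_p) (S : 'M[R]_(p, n)) (theta : 'cV[R]_n)
    (z : 'cV[R]_m) (lambda : 'cV[R]_p) : Prop :=
  [/\ H *m z + G^T *m lambda = 0,
      qp_feasible G b S theta z,
      vle 0 lambda
    & forall i, lambda i 0 * ((G *m z) i 0 - (b + S *m theta) i 0) = 0].

(* When G_A has full row rank the multiplier lambda is unique, so quantifying
   it existentially is not a choice. *)
Definition optimal_active_set (R : realType) (m n p : nat) (H : 'M[R]_m)
    (G : 'M[R]_(p, m)) (b : 'cV[R]_p) (S : 'M[R]_(p, n))
    (Theta : 'cV[R]_n -> Prop) (A : {set 'I_p}) : Prop :=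
  exists (theta : 'cV[R]_n) (z : 'cV[R]_m) (lambda : 'cV[R]_p),
    [/\ Theta theta,
        qp_optimal H G b S theta z,
        A = [set i | (G *m z) i 0 == (b + S *m theta) i 0],
        qp_KKT H G b S theta z lambda
      & forall i, i \in A -> lambda i 0 != 0].

Definition Wmx (R : realType) (m p : nat) (H : 'M[R]_m) (G : 'M[R]_(p, m))
    (A : {set 'I_p}) : 'M[R]_#|A| :=
  rowsof A G *m invmx H *m (rowsof A G)^T.

Definition sol_q (R : realType) (m p : nat) (H : 'M[R]_m) (G : 'M[R]_(p, m))
    (b : 'cV[R]_p) (A : {set 'I_p}) : 'cV[R]_p :=
  fillrows (- (invmx (Wmx H G A) *m rowsof A b)).

Definition sol_Q (R : realType) (m n p : nat) (H : 'M[R]_m)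
    (G : 'M[R]_(p, m)) (S : 'M[R]_(p, n)) (A : {set 'I_p}) : 'M[R]_(p, n) :=
  fillrows (- (invmx (Wmx H G A) *m rowsof A S)).

Definition sol_k (R : realType) (m p : nat) (H : 'M[R]_m) (G : 'M[R]_(p, m))
    (b : 'cV[R]_p) (A : {set 'I_p}) : 'cV[R]_m :=
  - (invmx H *m (rowsof A G)^T *m rowsof A (sol_q H G b A)).

Definition sol_K (R : realType) (m n p : nat) (H : 'M[R]_m)
    (G : 'M[R]_(p, m)) (S : 'M[R]_(p, n)) (A : {set 'I_p}) : 'M[R]_(m, n) :=
  - (invmx H *m (rowsof A G)^T *m rowsof A (sol_Q H G S A)).

(* Rank-one modification data for adding l to A, meaningful when l \notin A. *)
Definition r1_w (R : realType) (m p : nat) (H : 'M[R]_m) (G : 'M[R]_(p, m))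
    (A : {set 'I_p}) (l : 'I_p) : 'cV[R]_#|A| :=
  rowsof A G *m invmx H *m (row l G)^T.

Definition r1_C (R : realType) (m p : nat) (H : 'M[R]_m) (G : 'M[R]_(p, m))
    (A : {set 'I_p}) (l : 'I_p) : R :=
  (row l G *m invmx H *m (row l G)^T) 0 0
  - ((r1_w H G A l)^T *m invmx (Wmx H G A) *m r1_w H G A l) 0 0.

Definition r1_c (R : realType) (m p : nat) (H : 'M[R]_m) (G : 'M[R]_(p, m))
    (b : 'cV[R]_p) (A : {set 'I_p}) (l : 'I_p) : R :=
  (r1_C H G A l)^-1 *
  (((r1_w H G A l)^T *m invmx (Wmx H G A) *m rowsof A b) 0 0 - b l 0).

Definition r1_v (R : realType) (m n p : nat) (H : 'M[R]_m)
    (G : 'M[R]_(p, m)) (S : 'M[R]_(p, n)) (A : {set 'I_p}) (l : 'I_p)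
    : 'cV[R]_n :=
  (r1_C H G A l)^-1 *:
  ((rowsof A S)^T *m invmx (Wmx H G A) *m r1_w H G A l - (row l S)^T).

Definition r1_d (R : realType) (m p : nat) (H : 'M[R]_m) (G : 'M[R]_(p, m))
    (A : {set 'I_p}) (l : 'I_p) : 'cV[R]_p :=
  \col_i if i == l then -1
         else fillrows (invmx (Wmx H G A) *m r1_w H G A l) i 0.

Definition r1_f (R : realType) (m p : nat) (H : 'M[R]_m) (G : 'M[R]_(p, m))
    (A : {set 'I_p}) (l : 'I_p) : 'cV[R]_m :=
  invmx H *m (rowsof (l |: A) G)^T *m rowsof (l |: A) (r1_d H G A l).

(* Main.v *)
Require Import Defs.
From HB Require Import structures.
From mathcomp Require Import all_boot all_order all_algebra.
From mathcomp Require Import reals.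

Set Implicit Arguments.
Unset Strict Implicit.
Unset Printing Implicit Defensive.

Import Order.TTheory GRing.Theory Num.Theory.
Local Open Scope ring_scope.

(* Let D = G H^-1 G^T be the Hessian of the dual problem.  For a right-hand
   side B, sol_Q H G B A is the unique X supported on A such that D X = - B on
   the rows in A; the vector b and the matrix S are two instances of B.
   Let C, d and v be the rank-one data for adding l to A.  The vector d is
   supported on l |: A, and D d vanishes on A and equals - C at l.  Hence
   subtracting d v^T from the solution for A keeps the equations on A, and v^T
   is the row for which the equation at l holds as well: the result is the
   solution for l |: A.  Uniqueness also gives C != 0, since C = 0 would make
   the nonzero vector d a solution for B = 0.  The primal solution is the image
   of the multipliers under - H^-1 G^T. *)

Section PositiveDefinite.

Variable R : realType.

Lemma posdef_unitmx (m : nat) (H : 'M[R]_m) : posdef H -> H \in unitmx.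
Proof.
move=> [_ H_gt0]; rewrite -row_free_unit; apply: inj_row_free => u.
apply: contraPeq => u_neq0 uH0; have := H_gt0 u^T.
by rewrite trmxK uH0 mul0mx mxE ltxx trmx_eq0 => /(_ u_neq0).
Qed.

Lemma posdef_congr (k m : nat) (H : 'M[R]_m) (L : 'M[R]_(k, m)) :
  posdef H -> row_free L -> posdef (L *m H *m L^T).
Proof.
move=> [H_sym H_gt0] L_free; split=> [|z z_neq0].
  by rewrite !trmx_mul trmxK H_sym mulmxA.
have := H_gt0 (L^T *m z); rewrite trmx_mul trmxK !mulmxA; apply.
by rewrite -trmx_eq0 trmx_mul trmxK mulmx_free_eq0 // trmx_eq0.
Qed.

Lemma posdef_invmx (m : nat) (H : 'M[R]_m) : posdef H -> posdef (invmx H).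
Proof.
move=> H_posdef; have H_unit := posdef_unitmx H_posdef.
have : row_free (invmx H) by rewrite row_free_unit unitmx_inv.
move/(posdef_congr H_posdef); have [H_sym _] := H_posdef.
by rewrite mulVmx // mul1mx trmx_inv H_sym.
Qed.

End PositiveDefinite.

Lemma row_free_rowsub (F : fieldType) (k m n : nat) (f : 'I_k -> 'I_m)
    (M : 'M[F]_(m, n)) :
  injective f -> row_free M -> row_free (rowsub f M).
Proof.
move=> f_inj M_free; rewrite rowsubE /row_free mxrankMfree //.
apply/row_freeP; exists (rowsub f 1%:M)^T; apply/matrixP=> i j.
by rewrite mul_rowsub_mx mul1mx !mxE (inj_eq f_inj) eq_sym.
Qed.

Section RowSelection.

Variables (R : realType) (p : nat).
Implicit Types (A B : {set 'I_p}) (i : 'I_p).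

Definition supported_on (k : nat) A (M : 'M[R]_(p, k)) : Prop :=
  forall i j, i \notin A -> M i j = 0.

Lemma supported_onS (k : nat) A B (M : 'M[R]_(p, k)) :
  A \subset B -> supported_on A M -> supported_on B M.
Proof.
by move=> /subsetP sAB MA i j iB; apply: MA; apply: contraNN iB; apply: sAB.
Qed.

Lemma supported_onB (k : nat) A (M N : 'M[R]_(p, k)) :
  supported_on A M -> supported_on A N -> supported_on A (M - N).
Proof. by move=> MA NA i j iA; rewrite !mxE MA // NA // subr0. Qed.

Lemma supported_onM (k n : nat) A (M : 'M[R]_(p, k)) (N : 'M[R]_(k, n)) :
  supported_on A M -> supported_on A (M *m N).
Proof.
by move=> MA i j iA; rewrite mxE big1 // => a _; rewrite MA // mul0r.
Qed.

Lemma rowsofP (k : nat) A (M N : 'M[R]_(p, k)) :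
  rowsof A M = rowsof A N <-> {in A, forall i, row i M = row i N}.
Proof.
split=> [MN i iA|MN].
  by rewrite -(enum_rankK_in iA iA) -!row_rowsub -/(rowsof A _) MN.
by apply/row_matrixP=> a; rewrite !row_rowsub MN // enum_valP.
Qed.

HB.instance Definition _ (k : nat) A :=
  GRing.Linear.copy (@rowsof R p k A) (rowsub (@enum_val _ (mem A))).

Lemma rowsofE (k : nat) A (M : 'M[R]_(p, k)) :
  rowsof A M = rowsof A 1%:M *m M.
Proof. exact: rowsubE. Qed.

Lemma rowsofM (k n : nat) A (M : 'M[R]_(p, k)) (N : 'M[R]_(k, n)) :
  rowsof A (M *m N) = rowsof A M *m N.
Proof. exact: esym (mul_rowsub_mx _ _ _). Qed.

Lemma fillrowsE (k : nat) A (M : 'M[R]_(#|A|, k)) :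
  fillrows M = (rowsof A 1%:M)^T *m M.
Proof.
apply/matrixP=> i j; rewrite !mxE big_mkcond; apply: eq_bigr => a _.
by rewrite !mxE; case: eqP => _; rewrite ?mul1r ?mul0r.
Qed.

Lemma supported_on_fillrows (k : nat) A (M : 'M[R]_(#|A|, k)) :
  supported_on A (fillrows M).
Proof.
move=> i j iA; rewrite mxE big1 // => a /eqP a_i.
by rewrite -a_i enum_valP in iA.
Qed.

Lemma fillrowsK (k : nat) A (M : 'M[R]_(p, k)) :
  supported_on A M -> fillrows (rowsof A M) = M.
Proof.
move=> MA; apply/row_matrixP=> i; have [iA|iA] := boolP (i \in A).
  by have /rowsofP-> := rowsof_fillrows (rowsof A M).
by apply/rowP=> j; rewrite [LHS]mxE [RHS]mxE MA // supported_on_fillrows.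
Qed.

Lemma mul_tr_rowsof (m k : nat) A (G : 'M[R]_(p, m)) (M : 'M[R]_(#|A|, k)) :
  (rowsof A G)^T *m M = G^T *m fillrows M.
Proof. by rewrite rowsofE trmx_mul fillrowsE mulmxA. Qed.

Lemma row_free_rowsofS (m : nat) A B (G : 'M[R]_(p, m)) :
  A \subset B -> row_free (rowsof B G) -> row_free (rowsof A G).
Proof.
move=> sAB GB_free; pose f a := enum_val (a : 'I_#|A|).
have fB a : f a \in B by apply: (subsetP sAB); apply: enum_valP.
pose g a := enum_rank_in (fB a) (f a).
have gK a : enum_val (g a) = f a by rewrite enum_rankK_in.
have -> : rowsof A G = rowsub g (rowsof B G).
  by apply/matrixP=> a j; rewrite !mxE gK.
apply: row_free_rowsub => // a a' /(congr1 enum_val).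
by rewrite !gK => /enum_val_inj.
Qed.

End RowSelection.

Section DualSystem.

Variables (R : realType) (m p : nat) (H : 'M[R]_m) (G : 'M[R]_(p, m)).
Implicit Types (A : {set 'I_p}) (l : 'I_p).

Definition dual_hessian : 'M[R]_p := G *m invmx H *m G^T.

Lemma rowsof_dual_hessian (k : nat) A (Y : 'M[R]_(#|A|, k)) :
  rowsof A (dual_hessian *m fillrows Y) = Wmx H G A *m Y.
Proof. by rewrite -!mulmxA -mul_tr_rowsof rowsofM !mulmxA. Qed.

Lemma Wmx_unit A :
  posdef H -> row_free (rowsof A G) -> Wmx H G A \in unitmx.
Proof.
by move=> /posdef_invmx Hi_posdef GA_free; apply/posdef_unitmx/posdef_congr.
Qed.

Lemma sol_QP (n : nat) (B X : 'M[R]_(p, n)) A :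
  Wmx H G A \in unitmx ->
  X = sol_Q H G B A <->
  supported_on A X /\
  {in A, forall i, row i (dual_hessian *m X) = row i (- B)}.
Proof.
move=> WA_unit; rewrite -rowsofP; split=> [->|[XA DX]].
  split; first exact: supported_on_fillrows.
  by rewrite rowsof_dual_hessian mulmxN mulKVmx // linearN.
rewrite -(fillrowsK XA) in DX *; congr fillrows.
apply: (can_inj (mulKmx WA_unit)); rewrite -rowsof_dual_hessian DX.
by rewrite mulmxN mulKVmx // linearN.
Qed.

Lemma sol_KE (n : nat) (S : 'M[R]_(p, n)) A :
  sol_K H G S A = - (invmx H *m G^T *m sol_Q H G S A).
Proof. by rewrite /sol_K rowsof_fillrows -!mulmxA mul_tr_rowsof. Qed.

Lemma sol_kE (b : 'cV[R]_p) A :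
  sol_k H G b A = - (invmx H *m G^T *m sol_q H G b A).
Proof. exact: sol_KE. Qed.

Lemma primal_solutionE (n : nat) (b : 'cV[R]_p) (S : 'M[R]_(p, n)) A
    (theta : 'cV[R]_n) :
  sol_k H G b A + sol_K H G S A *m theta =
  - (invmx H *m G^T *m (sol_q H G b A + sol_Q H G S A *m theta)).
Proof. by rewrite sol_kE sol_KE mulNmx -opprD mulmxDr !mulmxA. Qed.

Lemma supported_on_r1_d A l : supported_on (l |: A) (r1_d H G A l).
Proof.
move=> i j; rewrite in_setU1 negb_or mxE => /andP[/negPf-> iA].
exact: supported_on_fillrows.
Qed.

Lemma r1_fE A l : r1_f H G A l = invmx H *m G^T *m r1_d H G A l.
Proof.
by rewrite /r1_f -!mulmxA mul_tr_rowsof fillrowsK //; apply: supported_on_r1_d.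
Qed.

End DualSystem.

Section RankOneUpdate.

Variables (R : realType) (m p : nat) (H : 'M[R]_m) (G : 'M[R]_(p, m)).
Variables (A : {set 'I_p}) (l : 'I_p).
Hypotheses (H_sym : H^T = H) (lA : l \notin A).
Hypothesis (WA_unit : Wmx H G A \in unitmx).
Hypothesis (WlA_unit : Wmx H G (l |: A) \in unitmx).

Local Notation D := (dual_hessian H G).
Local Notation W := (Wmx H G A).
Local Notation w := (r1_w H G A l).
Local Notation C := (r1_C H G A l).
Local Notation d := (r1_d H G A l).

Lemma r1_dE : d = fillrows (invmx W *m w) - delta_mx l 0.
Proof.
apply/colP=> i; rewrite [LHS]mxE [RHS]mxE [in X in _ + X]mxE.
rewrite [delta_mx _ _ _ _]mxE eqxx andbT; case: eqP => [->|_].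
  by rewrite supported_on_fillrows // sub0r.
by rewrite subr0.
Qed.

Lemma row_dual_hessian_fillrows (k : nat) (Y : 'M[R]_(#|A|, k)) :
  row l (D *m fillrows Y) = w^T *m Y.
Proof.
rewrite /r1_w !trmx_mul trmxK trmx_inv H_sym -!mulmxA mul_tr_rowsof.
by rewrite -row_mul !mulmxA.
Qed.

Lemma row_dual_hessian_r1_d_active : {in A, forall i, row i (D *m d) = 0}.
Proof.
suff DdA0 : rowsof A (D *m d) = rowsof A 0.
  by move=> i iA; have /rowsofP-> := DdA0; rewrite ?row0.
rewrite r1_dE mulmxBr linearB /= rowsof_dual_hessian mulKVmx //.
by rewrite -colE /r1_w tr_row !colE mulmxA !rowsofM subrr linear0.
Qed.

Lemma row_dual_hessian_r1_d_added : row l (D *m d) = (- C)%:M.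
Proof.
rewrite r1_dE mulmxBr linearB /= row_dual_hessian_fillrows mulmxA.
rewrite /r1_C opprB raddfB /= -!mx11_scalar; congr (_ - _).
by rewrite -!mulmxA -colE tr_row !colE mulmxA -!row_mul !mulmxA.
Qed.

Lemma r1_C_neq0 : C != 0.
Proof.
apply/eqP=> C0; have d_homogeneous : d = sol_Q H G 0 (l |: A).
  apply/sol_QP => //; split=> [|i]; first exact: supported_on_r1_d.
  rewrite oppr0 row0 => /setU1P[->|iA].
    by rewrite row_dual_hessian_r1_d_added C0 oppr0 raddf0.
  exact: row_dual_hessian_r1_d_active.
have /colP/(_ l)/eqP : d = 0.
  by rewrite d_homogeneous /sol_Q linear0 mulmx0 oppr0 fillrowsE mulmx0.
by rewrite !mxE eqxx oppr_eq0 oner_eq0.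
Qed.

Lemma tr_r1_v (n : nat) (B : 'M[R]_(p, n)) :
  (r1_v H G B A l)^T = C^-1 *: (w^T *m invmx W *m rowsof A B - row l B).
Proof.
have Wi_sym : (invmx W)^T = invmx W.
  by rewrite trmx_inv !trmx_mul trmxK trmx_inv H_sym mulmxA.
by rewrite linearZ linearB /= !trmx_mul !trmxK Wi_sym mulmxA.
Qed.

Lemma r1_c_scalar_mx (b : 'cV[R]_p) :
  (r1_c H G b A l)%:M = (r1_v H G b A l)^T.
Proof.
rewrite tr_r1_v -scale_scalar_mx raddfB /= -mx11_scalar.
by congr (_ *: (_ - _)); rewrite [RHS]mx11_scalar mxE.
Qed.

Lemma sol_Q_setU1 (n : nat) (B : 'M[R]_(p, n)) :
  sol_Q H G B (l |: A) = sol_Q H G B A - d *m (r1_v H G B A l)^T.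
Proof.
apply/esym/sol_QP => //; split=> [|i].
  apply: supported_onB; last exact/supported_onM/supported_on_r1_d.
  exact: supported_onS (subsetUr _ _) (supported_on_fillrows _).
rewrite mulmxBr linearB /= mulmxA [row i (_ *m _^T)]row_mul => /setU1P[->|iA].
  rewrite row_dual_hessian_fillrows row_dual_hessian_r1_d_added tr_r1_v.
  rewrite mul_scalar_mx scalerA mulNr divff ?r1_C_neq0 // scaleN1r opprK.
  by rewrite mulmxN mulmxA addKr linearN.
have [_ ->//] := (sol_QP B _ WA_unit).1 erefl.
by rewrite row_dual_hessian_r1_d_active // mul0mx subr0.
Qed.

Lemma sol_q_setU1 (b : 'cV[R]_p) :
  sol_q H G b (l |: A) = sol_q H G b A - r1_c H G b A l *: d.
Proof. by rewrite -mul_mx_scalar r1_c_scalar_mx -sol_Q_setU1. Qed.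

Lemma multipliers_setU1 (n : nat) (b : 'cV[R]_p) (S : 'M[R]_(p, n))
    (theta : 'cV[R]_n) :
  sol_q H G b (l |: A) + sol_Q H G S (l |: A) *m theta =
  sol_q H G b A + sol_Q H G S A *m theta
  - (r1_c H G b A l + ((r1_v H G S A l)^T *m theta) 0 0) *: d.
Proof.
rewrite sol_q_setU1 sol_Q_setU1 mulmxBl -mulmxA.
by rewrite {1}[_^T *m _]mx11_scalar mul_mx_scalar addrACA -opprD -scalerDl.
Qed.

End RankOneUpdate.

Theorem theorem2 (R : realType) (m n p : nat)
    (H : 'M[R]_m) (G : 'M[R]_(p, m)) (b : 'cV[R]_p) (S : 'M[R]_(p, n))
    (Theta : 'cV[R]_n -> Prop) (Ai Aj : {set 'I_p}) (l : 'I_p)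
    (H_posdef : posdef H)
    (Theta_polyhedral : polyhedral Theta)
    (Aj_optimal : optimal_active_set H G b S Theta Aj)
    (l_in_Aj : l \in Aj)
    (Ai_def : Ai = Aj :\ l)
    (Ai_optimal : optimal_active_set H G b S Theta Ai)
    (GAj_full_row_rank : row_free (rowsof Aj G)) :
  let ci := r1_c H G b Ai l in
  let vi := r1_v H G S Ai l in
  let di := - r1_d H G Ai l in
  let fi := - r1_f H G Ai l in
  forall theta : 'cV[R]_n,
    sol_q H G b Ai + sol_Q H G S Ai *m theta
      = sol_q H G b Aj + sol_Q H G S Aj *m theta
        - (ci + (vi^T *m theta) 0 0) *: di
    /\
    sol_k H G b Ai + sol_K H G S Ai *m theta
      = sol_k H G b Aj + sol_K H G S Aj *m theta
        + (ci + (vi^T *m theta) 0 0) *: fi.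
Proof.
move=> ci vi di fi theta; have [H_sym _] := H_posdef.
have lAi : l \notin Ai by rewrite Ai_def setD11.
have AjE : l |: Ai = Aj by rewrite Ai_def setD1K.
have GAi_full_row_rank : row_free (rowsof Ai G).
  by rewrite (row_free_rowsofS _ GAj_full_row_rank) // -AjE subsetUr.
have WAi_unit := Wmx_unit H_posdef GAi_full_row_rank.
have WAj_unit := Wmx_unit H_posdef GAj_full_row_rank.
rewrite !primal_solutionE /fi r1_fE -{}AjE in WAj_unit *.
rewrite multipliers_setU1 // /di !scalerN opprK subrK; split=> //.
by rewrite mulmxBr -scalemxAr opprB addrAC subrr add0r.
Qed.
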